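(* Let $k\ge 2$ be a fixed integer and $\varepsilon>0$ a fixed real number. For a prime $p$ let $p'$ denote the least prime exceeding $p$, and let $$\lambda(p)=\frac{1}{\mathrm{Log}_k(p)\,(\log_k p)^{\varepsilon}} .$$ Then (unconditionally) the sum over primes $$\sum_{\substack{p\le x\\ p'-p\le \lambda(p)\log p}}\frac1p$$ is bounded as $x\to\infty$.
   Context: $\log_1=\log$ is the natural logarithm and, for $j\ge 2$, $\log_j=\log\log_{j-1}$ is the $j$-th iterated logarithm. For $k\ge2$, $\mathrm{Log}_k(t)=\prod_{2\le j\le k}\log_j t$. The finitely many small integers at which these functions are not defined are ignored: the sum is restricted to those primes $p$ for which $\log_k p$ is defined and positive. *)

(* Defs.v *)
From mathcomp Require Import all_boot all_order all_algebra.
From mathcomp Require Import all_classical all_reals all_analysis.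

Set Implicit Arguments.
Unset Strict Implicit.
Unset Printing Implicit Defensive.

Import Order.TTheory GRing.Theory Num.Theory.
Import numFieldNormedType.Exports.

Local Open Scope ring_scope.

Lemma ex_prime_above (n : nat) : exists p, (n < p)%N && prime p.
Proof. by have [p np pp] := prime_above n; exists p; rewrite np. Qed.

Definition next_prime (n : nat) : nat := ex_minn (ex_prime_above n).

(* iter_ln 0 is the identity and iter_ln 1 is ln. *)
Definition iter_ln (R : realType) (j : nat) (t : R) : R := iter j (@ln R) t.

(* The library's ln is total (ln t = 0 for t <= 0), so definedness is stated
   explicitly: log_k t is defined iff t, log_1 t, ..., log_(k-1) t are all
   positive. Here log_k t itself, the case j = k, is required positive too. *)
Definition iter_ln_pos (R : realType) (k : nat) (t : R) : bool :=
  [forall j : 'I_k.+1, 0 < iter_ln j t].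

Definition Log (R : realType) (k : nat) (t : R) : R :=
  \prod_(2 <= j < k.+1) iter_ln j t.

Definition lambda (R : realType) (k : nat) (eps t : R) : R :=
  1 / (Log k t * iter_ln k t `^ eps).

(* For 0 <= x the naturals below (truncn x).+1 are exactly those p with
   p <= x; for x < 0 the range is {0}, which contains no prime. *)
Definition small_gap_sum (R : realType) (k : nat) (eps x : R) : R :=
  \sum_(0 <= p < (Num.truncn x).+1 |
        [&& prime p, iter_ln_pos k (p%:R : R)
          & (next_prime p)%:R - p%:R <= lambda k eps p%:R * ln (p%:R : R)])
     1 / p%:R.

(* Main.v *)
Require Import Defs.
From mathcomp Require Import all_boot all_order all_algebra.
From mathcomp Require Import zify ring lra.

Set Implicit Arguments.
Unset Strict Implicit.
Unset Printing Implicit Defensive.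

Import Order.TTheory GRing.Theory Num.Theory.

Local Open Scope ring_scope.

(** Selberg's sieve bounds, for each [h], the number of primes [p < 2^(m+1)] with
    [p + h] prime by a constant times [2^m / m^2 * prod_(p | h) (1 - 1/p)^-2].
    The arithmetic factor is bounded on average over [h <= H], so a dyadic block
    contains [O(H 2^m / m^2)] primes followed by a gap at most [H].  With [H] about
    [lambda(2^m) m], the block contributes [O(lambda(2^m) / m)] to the sum of
    reciprocals, and this is dominated by the increment of [-(log_k t)^-eps] over
    the previous block, so that the total telescopes.

    Only orders of magnitude matter, so the sieve uses just the odd primes
    [q <= w] not dividing [h], each removing exactly two residue classes, with level
    [w^2] for [w = 2^(m/14)]; trivial bounds then suffice for the weights and for
    the remainder.  The main term needs no prime number estimate: the sum over
    squarefree [d] dominates the square of a harmonic sum. *)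

(** * Sums over squarefree integers *)

Lemma sum_dvd_reindex (V : nmodType) (F : nat -> V) (p z : nat) : (0 < p)%N ->
  \sum_(1 <= n < z.+1 | (p %| n)%N) F n = \sum_(1 <= n < (z %/ p).+1) F (p * n)%N.
Proof.
move=> p0; elim: z => [|z IHz]; first by rewrite div0n !big_geq.
rewrite divnS // big_mkcond big_nat_recr //= -big_mkcond IHz.
case: ifP => pz; rewrite ?addr0 //=.
rewrite [in RHS]big_nat_recr //=; congr (_ + F _).
by have /eqP := divnS z p0; rewrite pz add1n => /eqP <-; rewrite mulnC divnK.
Qed.

(* For a list [s] of distinct primes, the sum of [prod_(p | d) f p] over the squarefree
   [d <= z] composed of primes of [s]; see [sqfsum_sets]. *)
Fixpoint sqfsum (R : nzRingType) (f : nat -> R) (s : seq nat) (z : nat) : R :=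
  if s is p :: s' then sqfsum f s' z + f p * sqfsum f s' (z %/ p)
  else (0 < z)%:R.

Lemma sqfsum_ge0 (R : realFieldType) (f : nat -> R) (s : seq nat) (z : nat) :
  {in s, forall p, 0 <= f p} -> 0 <= sqfsum f s z.
Proof.
elim: s z => [|p s IHs] z f0 /=; first exact: ler0n.
have fs : {in s, forall q, 0 <= f q} by move=> q qs; apply: f0; rewrite inE qs orbT.
by rewrite addr_ge0 ?mulr_ge0 ?IHs ?f0 ?mem_head.
Qed.

Lemma le_sqfsum (R : realFieldType) (f : nat -> R) (s : seq nat) (z w : nat) :
  {in s, forall p, 0 <= f p} -> (z <= w)%N -> sqfsum f s z <= sqfsum f s w.
Proof.
elim: s z w => [|p s IHs] z w f0 zw /=.
  by rewrite ler_nat; case: z w zw => [|z] [|w].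
have fs : {in s, forall q, 0 <= f q} by move=> q qs; apply: f0; rewrite inE qs orbT.
by rewrite lerD ?IHs // ler_wpM2l ?f0 ?mem_head ?IHs // leq_div2r.
Qed.

(** Discarding a prime [p] costs at most a factor [1 + f p], because the terms divisible by [p] are
    [f p] times a sum with the smaller bound [z %/ p]. *)
Lemma sqfsum_filter (R : realFieldType) (f : nat -> R) (a : pred nat)
    (s : seq nat) (z : nat) : {in s, forall p, 0 <= f p} ->
  sqfsum f s z <= (\prod_(p <- s | ~~ a p) (1 + f p)) * sqfsum f [seq p <- s | a p] z.
Proof.
elim: s z => [|p s IHs] z f0 /=; first by rewrite big_nil mul1r.
have fs : {in s, forall q, 0 <= f q} by move=> q qs; apply: f0; rewrite inE qs orbT.
have fp : 0 <= f p by rewrite f0 ?mem_head.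
have P0 : 0 <= \prod_(q <- s | ~~ a q) (1 + f q).
  by rewrite big_seq_cond prodr_ge0 // => q /andP[qs _]; rewrite addr_ge0 ?fs.
rewrite big_cons; case: (a p) => /=.
  rewrite mulrDr lerD ?IHs // mulrCA ler_wpM2l ?IHs //.
apply: (@le_trans _ _ (sqfsum f s z + f p * sqfsum f s z)).
  by rewrite lerD // ler_wpM2l // le_sqfsum // leq_div.
by rewrite -[X in X + _]mul1r -mulrDl -mulrA ler_wpM2l ?addr_ge0 ?IHs.
Qed.

(** A pair [(d, e)] is sent to its least common multiple, which is at most [z * w]. Each prime of
    the latter divides [d] only, [e] only, or both, whence the condition
    [2 * f p + f p ^+ 2 <= g p]. *)
Lemma sqfsum_mul (R : realFieldType) (f g : nat -> R) (s : seq nat) (z w : nat) :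
  {in s, forall p, (0 < p)%N /\ 0 <= f p} ->
  {in s, forall p, 2 * f p + f p ^+ 2 <= g p} ->
  sqfsum f s z * sqfsum f s w <= sqfsum g s (z * w).
Proof.
elim: s z w => [|p s IHs] z w f0 fg /=.
  by rewrite -natrM ler_nat; case: z w => [|z] [|w].
have f0s : {in s, forall q, (0 < q)%N /\ 0 <= f q}.
  by move=> q qs; apply: f0; rewrite inE qs orbT.
have fgs : {in s, forall q, 2 * f q + f q ^+ 2 <= g q}.
  by move=> q qs; apply: fg; rewrite inE qs orbT.
have [p0 fp] := f0 p (mem_head _ _).
have gs : {in s, forall q, 0 <= g q}.
  move=> q qs; apply: le_trans (fgs q qs).
  by have [_ fq] := f0s q qs; rewrite addr_ge0 ?mulr_ge0 ?exprn_ge0.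
have gp := fg p (mem_head _ _).
(* Each of the three cross terms involving the head [p] fits under the common bound
   [(z * w) %/ p]. *)
have key u v : (u * v <= (z * w) %/ p)%N ->
    sqfsum f s u * sqfsum f s v <= sqfsum g s ((z * w) %/ p).
  by move=> uv; apply: le_trans (IHs _ _ f0s fgs) (le_sqfsum gs uv).
have h1 := IHs z w f0s fgs.
have h2 : sqfsum f s (z %/ p) * sqfsum f s w <= sqfsum g s ((z * w) %/ p).
  by apply: key; rewrite leq_divRL // mulnAC leq_mul2r leq_trunc_div orbT.
have h3 : sqfsum f s z * sqfsum f s (w %/ p) <= sqfsum g s ((z * w) %/ p).
  by apply: key; rewrite leq_divRL // -mulnA leq_mul2l leq_trunc_div orbT.
have h4 : sqfsum f s (z %/ p) * sqfsum f s (w %/ p) <= sqfsum g s ((z * w) %/ p).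
  by apply: key; rewrite leq_divRL // -mulnA leq_mul ?leq_trunc_div ?leq_div.
have G0 := sqfsum_ge0 ((z * w) %/ p) gs.
rewrite mulrDl !mulrDr.
apply: (@le_trans _ _ (sqfsum g s (z * w) +
   (2 * f p + f p ^+ 2) * sqfsum g s ((z * w) %/ p))); last first.
  by rewrite lerD // ler_wpM2r.
have := ler_wpM2l fp h2; have := ler_wpM2l fp h3.
have := ler_wpM2l (exprn_ge0 2 fp) h4.
rewrite !(expr2, mulrDl).
set a := sqfsum f s z; set b := sqfsum f s w; set c := sqfsum f s (_ %/ _).
set d := sqfsum f s (_ %/ _); set e := sqfsum g s (_ %/ _).
by move: h1; rewrite -/a -/b => *; nra.
Qed.

Definition smooth (s : seq nat) (n : nat) := all (mem s) (primes n).

(** The factor [1/(p - 1)] is the geometric series over the positive powers of [p]. Only one power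
    is extracted at a time: strong induction on [z] closes up through
    [1/p + 1/p * 1/(p - 1) = 1/(p - 1)]. *)
Lemma smooth_harmonic_cons (R : realFieldType) (p : nat) (s : seq nat) (z : nat) :
  prime p ->
  \sum_(1 <= n < z.+1 | smooth (p :: s) n) (n%:R^-1 : R) <=
  \sum_(1 <= n < z.+1 | smooth s n) n%:R^-1 +
  (p.-1)%:R^-1 * \sum_(1 <= n < (z %/ p).+1 | smooth s n) n%:R^-1.
Proof.
move=> pp; have p1 := prime_gt1 pp; have p0 := prime_gt0 pp.
set N' := fun z => \sum_(1 <= n < z.+1 | smooth (p :: s) n) (n%:R^-1 : R).
set N := fun z => \sum_(1 <= n < z.+1 | smooth s n) (n%:R^-1 : R).
rewrite -/(N' z) -/(N z) -/(N (z %/ p)%N).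
have mono u v : (u <= v)%N -> N u <= N v.
  move=> uv; rewrite /N [leRHS](@big_cat_nat _ _ _ u.+1) //= lerDl.
  by rewrite sumr_ge0 // => n _; rewrite ?invr_ge0 ?ler0n.
have step u : N' u <= N u + p%:R^-1 * N' (u %/ p)%N.
  rewrite /N' (bigID (fun n => p %| n)%N) /= addrC lerD //.
    rewrite /N big_mkcond [leRHS]big_mkcond ler_sum_nat // => n /andP[n0 _].
    case: (boolP (smooth s n)) => [_|Ns].
      by case: ifP => _; rewrite ?invr_ge0 ?ler0n.
    case: ifP => // /andP[/allP sm pn]; case/negP: Ns; apply/allP => q qn.
    have := sm q qn; rewrite !inE => /orP[/eqP qp|//].
    by move: qn; rewrite mem_primes qp (negbTE pn) !andbF.
  rewrite big_mkcondl sum_dvd_reindex //.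
  rewrite big_distrr /= [leRHS]big_mkcond ler_sum_nat // => n /andP[n0 _].
  case: ifP => [/allP sm|_].
    rewrite natrM invfM; case: ifP => // /negP[]; apply/allP => q qn.
    apply: sm; rewrite mem_primes muln_gt0 p0 n0 /=.
    by move: qn; rewrite mem_primes => /and3P[-> _ /dvdn_mull ->].
  by case: ifP => // _; rewrite mulr_ge0 ?invr_ge0 ?ler0n.
have p1R : p%:R = p.-1%:R + 1 :> R by rewrite -{1}(prednK p0) -natr1.
have q0 : 0 < p.-1%:R :> R by rewrite ltr0n -subn1 subn_gt0.
elim/ltn_ind: z => -[_|z IHz].
  by rewrite /N' /N div0n !big_geq // mulr0 addr0.
have IH := IHz (z.+1 %/ p)%N (ltn_Pdiv p1 (ltn0Sn z)).
apply: (le_trans (step _)); rewrite lerD2l.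
apply: (@le_trans _ _ (p%:R^-1 * (N (z.+1 %/ p)%N + p.-1%:R^-1 * N (z.+1 %/ p)%N))).
  rewrite ler_wpM2l ?invr_ge0 ?ler0n // (le_trans IH) // lerD2l.
  by rewrite ler_wpM2l ?invr_ge0 ?ler0n // mono // leq_div.
rewrite le_eqVlt; apply/orP; left; apply/eqP.
by rewrite p1R; field; rewrite (lt0r_neq0 q0) lt0r_neq0 // addr_gt0.
Qed.

(** The integers with a given set of prime factors have reciprocals summing to the product of
    [1/(p - 1)] over that set, and the radical of [n] is at most [n]. *)
Lemma smooth_harmonic_le_sqfsum (R : realFieldType) (s : seq nat) (z : nat) :
  {in s, forall p, prime p} ->
  \sum_(1 <= n < z.+1 | smooth s n) (n%:R^-1 : R) <=
  sqfsum (fun p => (p.-1)%:R^-1) s z.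
Proof.
elim: s z => [|p s IHs] z sp /=.
  case: z => [|z]; first by rewrite big_geq.
  rewrite big_mkcond big_nat_recl //= big_nat big1 ?addr0 ?invr1 // => n /andP[n0 _].
  case: ifP => // /allP /(_ (pdiv n.+1)) /=.
  by rewrite mem_primes pdiv_prime // pdiv_dvd => /(_ isT).
have pp : prime p by apply: sp; rewrite mem_head.
have sp' : {in s, forall q, prime q} by move=> q qs; apply: sp; rewrite inE qs orbT.
apply: (le_trans (smooth_harmonic_cons _ _ _ pp)).
by rewrite lerD ?IHs // ler_wpM2l ?invr_ge0 ?ler0n ?IHs.
Qed.

(** * Selberg's weights *)

Lemma prod_if_split (R : comNzRingType) (I : finType) (D : {set I}) (a b : I -> R) :
  \prod_i (if i \in D then a i else b i) =
  (\prod_(i in D) a i) * \prod_(i in ~: D) b i.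
Proof.
rewrite (bigID (mem D)) /=; congr (_ * _).
  by apply: eq_bigr => i ->.
by apply: eq_big => [i|i /negbTE ->] //; rewrite inE.
Qed.

Lemma prod_add_subsets (R : comNzRingType) (I : finType) (a b : I -> R) :
  \prod_i (a i + b i) =
  \sum_(D : {set I}) (\prod_(i in D) a i) * \prod_(i in ~: D) b i.
Proof.
by rewrite bigA_distr; apply: eq_bigr => D _; rewrite prod_if_split.
Qed.

Lemma sum_subset_prod (R : comNzRingType) (I : finType) (A : {set I}) (a : I -> R) :
  \sum_(D : {set I} | D \subset A) \prod_(i in D) a i = \prod_(i in A) (1 + a i).
Proof.
have -> : \prod_(i in A) (1 + a i) = \prod_i ((if i \in A then a i else 0) + 1).
  rewrite big_mkcond; apply: eq_bigr => i _; case: ifP; rewrite ?add0r //.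
  by rewrite addrC.
rewrite prod_add_subsets big_mkcond; apply: eq_bigr => D _.
rewrite [X in _ * X]big1 // mulr1; case: ifP => [DA|/negbT].
  by apply: eq_bigr => i iD; rewrite (subsetP DA).
case/subsetPn => i iD iA.
by rewrite (bigD1 i) //= (negbTE iA) mul0r.
Qed.

(** Writing [D] as [B] together with a subset of [C :\: B] turns the sum into a product of factors
    [1 - 1] over [C :\: B], which vanishes unless that set is empty. *)
Lemma sum_interval_sign (R : comNzRingType) (I : finType) (B C : {set I}) :
  B \subset C ->
  \sum_(D : {set I} | (B \subset D) && (D \subset C)) (-1) ^+ #|D| =
  (B == C)%:R * (-1) ^+ #|B| :> R.
Proof.
move=> BC; rewrite (reindex_onto (fun D => B :|: D) (fun D => D :\: B)) /=; last first.
  by move=> D /andP[BD _]; rewrite setDE setUIr setUCr setIT; apply/setUidPr.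
transitivity (\sum_(D : {set I} | D \subset C :\: B)
   (-1) ^+ #|B| * \prod_(i in D) (-1 : R)).
  apply: eq_big => [D|D /andP[_ /eqP DB]].
    rewrite subsetUl subUset BC /= subsetD; congr (_ && _).
    by rewrite setDUl setDv set0U; apply/eqP/setDidPl.
  have BD : [disjoint B & D] by rewrite -DB disjoint_sym -setI_eq0 setIDAC setDIl setDv setI0.
  by rewrite cardsU (disjoint_setI0 BD) cards0 subn0 exprD prodr_const.
rewrite -mulr_sumr sum_subset_prod mulrC; congr (_ * _).
case: eqVneq => [->|BneC]; first by rewrite setDv big_set0.
have [i iC iB] : exists2 i, i \in C & i \notin B.
  by apply/subsetPn; apply: contra BneC => CB; rewrite eqEsubset BC.
by rewrite (bigD1 i) ?inE ?iB //= subrr mul0r.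
Qed.

Lemma prod_setUI (R : comNzRingType) (I : finType) (a : I -> R) (D E : {set I}) :
  (\prod_(i in D :|: E) a i) * \prod_(i in D :&: E) a i =
  (\prod_(i in D) a i) * \prod_(i in E) a i.
Proof.
rewrite (big_setID (A := D :|: E) E) (big_setID (A := D) E) /=.
rewrite setDUl setDv setU0 (setIidPr (subsetUr D E)).
by ring.
Qed.

(* The form is diagonalised by [rho (D :|: E) = rho D * rho E / rho (D :&: E)] and
   [1 / rho A = sum_(B \subset A) prod_(i in B) (1 - rho i) / rho i]; the weights are the
   Moebius inverse of the minimiser in the diagonal coordinates. *)
Lemma selberg_weights (R : realFieldType) (I : finType) (rho : I -> R)
    (DD : {set {set I}}) (G := \sum_(B in DD) \prod_(i in B) (rho i / (1 - rho i))) :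
  (forall i, 0 < rho i < 1) -> set0 \in DD ->
  (forall B D : {set I}, B \in DD -> D \subset B -> D \in DD) ->
  exists la : {set I} -> R,
    [/\ la set0 = 1,
        forall D, D \notin DD -> la D = 0,
        forall D, `|la D| <= \prod_(i in D) (rho i)^-1 &
        \sum_D \sum_E la D * la E * \prod_(i in D :|: E) rho i = G^-1].
Proof.
move=> rho01 DD0 DDdown.
pose g i := rho i / (1 - rho i).
pose gs (B : {set I}) := \prod_(i in B) g i.
pose rs (B : {set I}) := \prod_(i in B) rho i.
have rho0 i : 0 < rho i by have /andP[] := rho01 i.
have rho1 i : rho i < 1 by have /andP[] := rho01 i.
have g0 i : 0 < g i by rewrite divr_gt0 // subr_gt0.
have gs0 B : 0 < gs B by rewrite prodr_gt0.
have rs0 B : 0 < rs B by rewrite prodr_gt0.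
have G0 : 0 < G.
  rewrite /G (bigD1 set0) //= ltr_pwDl ?gs0 //.
  by rewrite sumr_ge0 // => B _; rewrite ltW ?gs0.
(* Up to sign, the weight of [D] will be [T D / (G * rs D)], so [0 <= T D <= G] yields the required
   bound on its absolute value. *)
pose T (D : {set I}) := \sum_(B in DD | D \subset B) gs B.
have TG (D : {set I}) : 0 <= T D <= G.
  rewrite /T sumr_ge0 => [|B _]; last exact: ltW.
  rewrite big_mkcondr /= ler_sum // => B _; case: ifP => // _.
  exact: (ltW (gs0 B)).
exists (fun D : {set I} => (-1) ^+ #|D| * T D / G / rs D); split.
- rewrite cards0 expr0 mul1r /rs big_set0 divr1 /T.
  rewrite (eq_bigl (mem DD)) => [|B]; last by rewrite sub0set andbT.
  by rewrite divff // lt0r_neq0.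
- move=> D DDD; rewrite /T big1 ?mulr0 ?mul0r // => B /andP[BD DB].
  by rewrite (DDdown _ _ BD DB) in DDD.
- move=> D; rewrite !normrM normr_sign mul1r.
  have /andP[T0 T1] := TG D.
  rewrite prodfV (ger0_norm T0) !gtr0_norm ?invr_gt0 //.
  by rewrite ler_piMl ?invr_ge0 ?(ltW (rs0 _)) // ler_pdivrMr // mul1r.
pose x (D : {set I}) := (-1) ^+ #|D| * T D / G.
(* Moebius inversion: after exchanging sums, each [C] in [DD] carries the signed count of the sets
   between [B] and [C], which is nonzero only for [C = B]. *)
have xsum (B : {set I}) : \sum_(D : {set I} | B \subset D) x D =
    (if B \in DD then (-1) ^+ #|B| * gs B / G else 0).
  under eq_bigr => D _ do rewrite /x /T mulr_sumr mulr_suml big_mkcondr /=.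
  rewrite exchange_big /=.
  transitivity (\sum_(C in DD) (B == C)%:R * ((-1) ^+ #|B| * gs C / G)).
    apply: eq_bigr => C CD; rewrite -big_mkcondr /=.
    rewrite -(eq_bigr _ (fun D _ => mulrA _ _ _)) -mulr_suml.
    case: (boolP (B \subset C)) => BC; first by rewrite sum_interval_sign // -!mulrA.
    rewrite big1 ?mul0r => [|D /andP[BD DC]]; last by rewrite (subset_trans BD DC) in BC.
    by case: eqVneq BC => [->|]; rewrite ?subxx ?mul0r.
  rewrite big_mkcond /= (bigD1 B) //= eqxx mul1r big1 ?addr0 // => C CB.
  by rewrite eq_sym (negbTE CB) mul0r; case: ifP.
have rsU (D E : {set I}) : rs (D :|: E) = rs D * rs E *
   \sum_(B : {set I} | (B \subset D) && (B \subset E)) (gs B)^-1.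
  have -> : \sum_(B : {set I} | (B \subset D) && (B \subset E)) (gs B)^-1 =
     (rs (D :&: E))^-1.
    under eq_bigl => B do rewrite -subsetI.
    rewrite /gs; under eq_bigr => B _ do rewrite -prodfV.
    rewrite sum_subset_prod -prodfV; apply: eq_bigr => i _; rewrite /g.
    have := rho0 i; have := rho1 i => h1 h2.
    by field; rewrite !lt0r_neq0 ?subr_gt0.
  by rewrite -[rs D * rs E]prod_setUI mulfK // lt0r_neq0 // rs0.
(* The form is now a sum of squares with coefficients [1 / gs B]; inserting [xsum] leaves
   [G / G ^+ 2]. *)
transitivity (\sum_(B : {set I}) (gs B)^-1 * (\sum_(D : {set I} | B \subset D) x D) ^+ 2).
  transitivity (\sum_(D : {set I}) \sum_(E : {set I}) \sum_(B : {set I})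
     (if B \subset D then if B \subset E then (gs B)^-1 * x D * x E else 0 else 0)).
    apply: eq_bigr => D _; apply: eq_bigr => E _.
    rewrite -/(x D) -/(x E) -[\prod_(i in _) _]/(rs (D :|: E)) rsU !mulr_sumr.
    rewrite big_mkcond; apply: eq_bigr => B _.
    case: ifP => [/andP[-> ->]|]; last by do 2?case: ifP => //.
    move: (x D) (x E) (rs0 D) (rs0 E) (gs0 B) => xD xE rD rE gB.
    by field; rewrite !lt0r_neq0.
  under eq_bigr => D _ do rewrite exchange_big /=.
  rewrite exchange_big /=; apply: eq_bigr => B _.
  rewrite expr2 mulr_suml mulr_sumr [RHS]big_mkcond; apply: eq_bigr => D _.
  case: ifP => _; last by rewrite big1.
  rewrite mulr_sumr mulr_sumr [RHS]big_mkcond; apply: eq_bigr => E _.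
  by case: ifP => // _; exact: esym (mulrA _ _ _).
under eq_bigr => B _ do rewrite xsum.
transitivity (\sum_(B in DD) gs B / G ^+ 2).
  rewrite [RHS]big_mkcond; apply: eq_bigr => B _; case: ifP => _; last first.
    by rewrite expr0n mulr0.
  rewrite !exprMn sqrr_sign mul1r exprVn mulrA expr2 mulrA mulVf ?mul1r //.
  exact: lt0r_neq0.
by rewrite -mulr_suml -/G expr2 invfM mulrA divff ?mul1r // lt0r_neq0.
Qed.

(** * Residue classes removed by the sieve *)

Lemma count_crt (m1 m2 : nat) (P Q : pred nat) : (0 < m1)%N -> (0 < m2)%N ->
  coprime m1 m2 ->
  (forall n, P (n %% m1)%N = P n) -> (forall n, Q (n %% m2)%N = Q n) ->
  (\sum_(n < m1 * m2 | P n && Q n) 1 = (\sum_(n < m1 | P n) 1) * (\sum_(n < m2 | Q n) 1))%N.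
Proof.
move=> m10 m20 co PP QQ; rewrite big_distrlr /= pair_big /=.
have m0 : (0 < m1 * m2)%N by rewrite muln_gt0 m10.
pose h (u : 'I_m1 * 'I_m2) : 'I_(m1 * m2) :=
  Ordinal (ltn_pmod (chinese m1 m2 u.1 u.2) m0).
pose h' (n : 'I_(m1 * m2)) : 'I_m1 * 'I_m2 :=
  (Ordinal (ltn_pmod n m10), Ordinal (ltn_pmod n m20)).
have hl u : (h u %% m1 = u.1 %% m1)%N.
  by rewrite /= modn_dvdm ?dvdn_mulr // chinese_modl.
have hr u : (h u %% m2 = u.2 %% m2)%N.
  by rewrite /= modn_dvdm ?dvdn_mull // chinese_modr.
rewrite (reindex h) /=; last first.
  exists h' => [[a b] _|n _].
    congr (_, _); apply: val_inj; rewrite /= -?/(h (a, b)).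
      by have := hl (a, b); rewrite /= (modn_small (ltn_ord a)).
    by have := hr (a, b); rewrite /= (modn_small (ltn_ord b)).
  apply: val_inj => /=; rewrite -[RHS](modn_small (ltn_ord n)).
  by rewrite [RHS](chinese_mod co n).
apply: eq_bigl => u; congr (_ && _).
  by rewrite -PP hl PP.
by rewrite -QQ hr QQ.
Qed.

(** The roots are [0] and [- h] modulo [q], distinct because [q] does not divide [h]. *)
Lemma count_pair_roots_prime (q h : nat) : prime q -> ~~ (q %| h)%N ->
  (\sum_(n < q | (q %| n * (n + h))%N) 1 = 2)%N.
Proof.
move=> pq qh; have q0 := prime_gt0 pq.
pose a : 'I_q := Ordinal q0.
have bq : (q - h %% q < q)%N.
  by rewrite ltn_subrL q0 andbT lt0n; apply: contra qh => /eqP qh; apply/eqP.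
pose b : 'I_q := Ordinal bq.
have hb : (q %| b + h)%N.
  rewrite /b /= {2}(divn_eq h q) addnCA subnK ?dvdn_addr ?dvdn_mull //.
  by rewrite ltnW // ltn_pmod.
have ab : a != b.
  apply: contra qh => /eqP ab; move: hb; rewrite -ab /= add0n => //.
transitivity (\sum_(n in [set a; b]) 1)%N; last by rewrite sum1_card cards2 ab.
apply: eq_bigl => n; rewrite !inE Euclid_dvdM //; congr (_ || _).
  apply/idP/eqP => [qn|->]; last exact: dvdn0.
  by apply: val_inj => /=; rewrite -(modn_small (ltn_ord n)); apply/eqP.
apply/idP/eqP => [qn|->] //; apply: val_inj => /=.
have : (n + h == b + h %[mod q])%N.
  by move: qn hb; rewrite /dvdn => /eqP -> /eqP ->.
by rewrite eqn_modDr (modn_small (ltn_ord n)) (modn_small (ltn_ord b)) => /eqP.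
Qed.

Definition pair_sieved (h : nat) (s : seq nat) (n : nat) :=
  all (fun q => q %| n * (n + h))%N s.

Lemma dvdn_pair_modn (q m h n : nat) : (q %| m)%N ->
  (q %| (n %% m) * (n %% m + h) = (q %| n * (n + h)))%N.
Proof.
move=> qm; rewrite /dvdn; congr (_ == 0)%N.
by rewrite -modnMm -modnDml !(modn_dvdm _ qm) modnDml modnMm.
Qed.

Lemma pair_sieved_modn (h : nat) (s : seq nat) (m n : nat) :
  (\prod_(q <- s) q %| m)%N -> pair_sieved h s (n %% m) = pair_sieved h s n.
Proof.
move=> sm; apply: eq_in_all => q qs; apply: dvdn_pair_modn.
apply: dvdn_trans sm; rewrite (big_rem q) //=; exact: dvdn_mulr.
Qed.

Lemma count_pair_roots (h : nat) (s : seq nat) : uniq s ->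
  {in s, forall q, prime q && ~~ (q %| h)%N} ->
  (\sum_(n < \prod_(q <- s) q | pair_sieved h s n) 1 = 2 ^ size s)%N.
Proof.
elim: s => [_ _|q s IHs] /=.
  by rewrite big_nil big_mkcond big_ord_recl big_ord0.
move=> /andP[qs us] sp.
have /andP[pq qh] := sp q (mem_head _ _).
have sp' : {in s, forall q, prime q && ~~ (q %| h)%N}.
  by move=> r rs; apply: sp; rewrite inE rs orbT.
have s0 : (0 < \prod_(q <- s) q)%N.
  by rewrite big_seq prodn_cond_gt0 // => r rs; rewrite prime_gt0 //; have /andP[] := sp' r rs.
have co : coprime q (\prod_(q <- s) q).
  rewrite prime_coprime // Euclid_dvd_prod // big_has; apply/hasPn => r rs.
  rewrite dvdn_prime2 //; last by have /andP[] := sp' r rs.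
  by apply: contra qs => /eqP ->.
rewrite big_cons expnS -IHs // -(count_pair_roots_prime pq qh).
rewrite -(count_crt (P := fun n => (q %| n * (n + h))%N) (Q := pair_sieved h s)) ?(prime_gt0 pq) //.
  by move=> n; apply: dvdn_pair_modn.
by move=> n; apply: pair_sieved_modn.
Qed.

Lemma count_periodic_bounds (m Y : nat) (P : pred nat) : (0 < m)%N ->
  (forall n, P (n %% m)%N = P n) ->
  ((Y %/ m) * (\sum_(n < m | P n) 1) <= \sum_(n < Y | P n) 1 <=
   (Y %/ m).+1 * (\sum_(n < m | P n) 1))%N.
Proof.
move=> m0 PP.
have per k : (\sum_(n < k * m | P n) 1 = k * \sum_(n < m | P n) 1)%N.
  elim: k => [|k IHk]; first by rewrite mul0n big_ord0.
  rewrite mulSn big_split_ord /= mulSn; congr (_ + _)%N.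
  by rewrite -IHk; apply: eq_bigl => n; rewrite -PP modnDl PP.
have mono u v : (u <= v)%N -> (\sum_(n < u | P n) 1 <= \sum_(n < v | P n) 1)%N.
  by move=> uv; rewrite -(subnKC uv) big_split_ord /= leq_addr.
by rewrite -!per !mono // ?leq_trunc_div // ltnW // ltn_ceil.
Qed.

(** The recursion of [sqfsum] is the split according to whether the head [i] belongs to [D];
    removing [i] from [D] lowers the bound on the product to [z %/ q i]. *)
Lemma sqfsum_sets (R : realFieldType) (I : finType) (q : I -> nat) (f : nat -> R)
    (s : seq I) (z : nat) : uniq s -> {in s, forall i, (0 < q i)%N} ->
  \sum_(D : {set I} | (D \subset [set i in s]) && (\prod_(i in D) q i <= z)%N)
     \prod_(i in D) f (q i) = sqfsum f [seq q i | i <- s] z.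
Proof.
elim: s z => [|i s IHs] z /=.
  move=> _ _; under eq_bigl => D.
    rewrite (_ : [set i in [::]] = set0) ?subset0; last by apply/setP => j; rewrite !inE.
    over.
  rewrite big_mkcondr /= big_pred1_eq !big_set0.
  by case: z.
move=> /andP[ns us] q0.
have qi : (0 < q i)%N by rewrite q0 ?mem_head.
have q0s : {in s, forall j, (0 < q j)%N} by move=> j js; rewrite q0 // inE js orbT.
rewrite (bigID (fun D : {set I} => i \in D)) /= addrC; congr (_ + _).
  rewrite -IHs //; apply: eq_bigl => D; rewrite andbAC; congr (_ && _).
  apply/andP/subsetP => [[/subsetP Ds iD] j jD|Ds].
    have := Ds j jD; rewrite !inE => /orP[/eqP ji|//].
    by rewrite -ji jD in iD.
  split; last by apply/negP => /Ds; rewrite inE (negbTE ns).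
  by apply/subsetP => j /Ds; rewrite !inE => ->; rewrite orbT.
rewrite (reindex_onto (fun D => i |: D) (fun D => D :\ i)) /=; last first.
  by move=> D /andP[_ iD]; rewrite setD1K.
rewrite -IHs // mulr_sumr.
have key (D : {set I}) : D \subset [set j in s] -> i \notin D.
  by move=> /subsetP Ds; apply/negP => /Ds; rewrite inE (negbTE ns).
apply: eq_big => [D|D].
  rewrite setU11 andbT.
  apply/andP/andP => [[/andP[Ds Dz] /eqP iD]|[Ds Dz]].
    have niD : i \notin D by rewrite -iD !inE eqxx.
    split; last by move: Dz; rewrite big_setU1 //= leq_divRL // mulnC.
    apply/subsetP => j jD; have /(subsetP Ds) : j \in i |: D by rewrite !inE jD orbT.
    by rewrite !inE => /orP[/eqP ji|//]; rewrite -ji jD in niD.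
  have niD := key D Ds; split; last by rewrite setU1K.
  rewrite big_setU1 //= mulnC -leq_divRL // Dz andbT.
  apply/subsetP => j; rewrite !inE => /orP[->//|/(subsetP Ds)].
  by rewrite !inE => ->; rewrite orbT.
by move=> /andP[_ /eqP iD]; rewrite big_setU1 //= -iD !inE eqxx.
Qed.

(** The condition is periodic modulo the product of the primes of [A] and holds on exactly
    [2 ^ #|A|] classes, so the error is at most the count in one period. *)
Lemma count_dvd_pair_error (R : realFieldType) (I : finType) (q : I -> nat)
    (h Y : nat) (A : {set I}) : injective q ->
  (forall i, prime (q i) && ~~ (q i %| h)%N) ->
  `|(\sum_(n < Y | A \subset [set i | (q i %| n * (n + h))%N]) 1)%N%:R
     - Y%:R * \prod_(i in A) (2 / (q i)%:R) : R| <= 2 ^+ #|A|.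
Proof.
move=> qinj qh; pose s := [seq q i | i <- enum A].
have us : uniq s by rewrite map_inj_uniq ?enum_uniq.
have sp : {in s, forall p, prime p && ~~ (p %| h)%N} by move=> _ /mapP[i _ ->].
have ss : size s = #|A| by rewrite size_map -cardE.
have sM : (\prod_(p <- s) p = \prod_(i in A) q i)%N by rewrite big_map big_enum.
have sE n : (A \subset [set i | (q i %| n * (n + h))%N]) = pair_sieved h s n.
  apply/subsetP/allP => [As _ /mapP[i + ->]|sA i iA].
    by rewrite mem_enum => /As; rewrite inE.
  by rewrite inE; apply: sA; rewrite map_f // mem_enum.
rewrite (eq_bigl (fun n : 'I_Y => pair_sieved h s n)); last by move=> n; apply: sE.
set M := (\prod_(i in A) q i)%N in sM.
have M0 : (0 < M)%N by rewrite prodn_cond_gt0 // => i _; rewrite prime_gt0 //; have /andP[] := qh i.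
have per n : pair_sieved h s (n %% M)%N = pair_sieved h s n.
  by apply: pair_sieved_modn; rewrite sM.
have cM : (\sum_(n < M | pair_sieved h s n) 1 = 2 ^ #|A|)%N.
  by rewrite -ss -(count_pair_roots us sp) sM.
have := count_periodic_bounds Y M0 per; rewrite cM.
set c := (\sum_(n < Y | _) 1)%N => /andP[].
have -> : \prod_(i in A) (2 / (q i)%:R) = 2 ^+ #|A| / M%:R :> R.
  by rewrite prodf_div prodr_const natr_prod.
have [MY YM] : (Y %/ M * M <= Y)%N /\ (Y <= (Y %/ M).+1 * M)%N.
  by rewrite leq_trunc_div ltnW // ltn_ceil.
move: MY YM; rewrite -!(ler_nat R) !natrM -natr1 natrX.
have MR0 : 0 < M%:R :> R by rewrite ltr0n.
set k := (Y %/ M)%N%:R => h1 h2 h3 h4.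
have e0 : 0 < 2 ^+ #|A| :> R by rewrite exprn_gt0.
have h5 : k <= Y%:R / M%:R by rewrite ler_pdivlMr.
have h6 : Y%:R / M%:R <= k + 1 by rewrite ler_pdivrMr.
have -> : Y%:R * (2 ^+ #|A| / M%:R) = Y%:R / M%:R * 2 ^+ #|A| :> R.
  by rewrite mulrA mulrAC.
have := ler_wpM2r (ltW e0) h5; have := ler_wpM2r (ltW e0) h6.
by rewrite ler_norml; move: h3 h4; rewrite !mulrDl mul1r => *; lra.
Qed.

(** * The sieve bound for prime pairs *)

(** The set is recovered from its product as the indices [i] for which [q i] divides it. *)
Lemma prime_prod_set_inj (I : finType) (q : I -> nat) : injective q ->
  (forall i, prime (q i)) -> injective (fun D : {set I} => \prod_(i in D) q i)%N.
Proof.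
move=> qinj qp.
have mem (D : {set I}) i : (i \in D) = (q i %| \prod_(j in D) q j)%N.
  rewrite Euclid_dvd_prod //; apply/idP/idP => [iD|].
    by rewrite (bigD1 i) //= dvdnn.
  rewrite big_has_cond => /hasP[j _ /andP[jD]].
  by rewrite dvdn_prime2 // => /eqP /qinj ->.
by move=> D E DE; apply/setP => i; rewrite !mem DE.
Qed.

Lemma card_prime_prod_le (I : finType) (q : I -> nat) (z : nat) : injective q ->
  (forall i, prime (q i)) ->
  (#|[set D : {set I} | \prod_(i in D) q i <= z]%N| <= z)%N.
Proof.
move=> qinj qp; rewrite cardE -(size_map (fun D : {set I} => \prod_(i in D) q i)%N).
rewrite -[leqRHS](size_iota 1) uniq_leq_size //.
  by rewrite map_inj_uniq ?enum_uniq //; apply: prime_prod_set_inj.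
move=> _ /mapP[D + ->]; rewrite mem_enum inE mem_iota add1n ltnS => ->.
by rewrite andbT prodn_cond_gt0 // => i _; rewrite prime_gt0.
Qed.

(** Two classes modulo [q] are removed, so the density is [rho = 2/q] and
    [rho / (1 - rho) = 2/(q - 2)]. The term [z ^ 6] bounds the remainder: at most [z ^ 2] pairs of
    sets, two weights of size at most [z], and a counting error of at most [z ^ 2]. *)
Lemma selberg_pair_bound (R : realFieldType) (h z Y : nat) (s : seq nat) :
  uniq s -> {in s, forall q, [/\ prime q, (2 < q)%N & ~~ (q %| h)%N]} -> (0 < z)%N ->
  (\sum_(n < Y | all (fun q => ~~ (q %| n * (n + h))%N) s) 1)%N%:R <=
  Y%:R / sqfsum (fun q => 2 / (q%:R - 2)) s z + (z ^ 6)%:R :> R.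
Proof.
move=> us sp z0; pose I := seq_sub s; pose q (i : I) := val i.
have qinj : injective q by apply: val_inj.
have qp i : [/\ prime (q i), (2 < q i)%N & ~~ (q i %| h)%N] by apply: sp; apply: valP.
have qp1 i : prime (q i) by case: (qp i).
have q2 i : 2 < (q i)%:R :> R by rewrite ltr_nat; case: (qp i).
(* A set of primes stands for the squarefree integer that is its product; the level of the sieve is
   [z]. *)
pose DD := [set D : {set I} | \prod_(i in D) q i <= z]%N.
pose rho i : R := 2 / (q i)%:R.
have rho01 i : 0 < rho i < 1.
  have := q2 i => h2; have h0 : 0 < (q i)%:R :> R by lra.
  by rewrite divr_gt0 //= ltr_pdivrMr // mul1r.
have DD0 : set0 \in DD by rewrite inE big_set0.
have DDdown (B D : {set I}) : B \in DD -> D \subset B -> D \in DD.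
  rewrite !inE => Bz /setIidPr DB; apply: leq_trans Bz.
  rewrite [leqRHS](big_setID D) /= DB leq_pmulr //.
  by rewrite prodn_cond_gt0 // => i _; rewrite prime_gt0.
have [la [la0 laDD lab laQ]] := selberg_weights rho01 DD0 DDdown.
have Gs : \sum_(B in DD) \prod_(i in B) (rho i / (1 - rho i)) =
    sqfsum (fun q => 2 / (q%:R - 2)) s z.
  transitivity (sqfsum (fun q => 2 / (q%:R - 2) : R) [seq q i | i <- seq_sub_enum s] z).
    2: by congr (sqfsum _ _ _); apply: val_seq_sub_enum.
  rewrite -sqfsum_sets ?undup_uniq //; last first.
    by move=> i _; rewrite prime_gt0 //; apply: qp1.
  apply: eq_big => [B|B _].
    rewrite inE (_ : [set i in _] = setT) ?subsetT //.
    by apply/setP => i; rewrite !inE mem_seq_sub_enum.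
  apply: eq_bigr => i _; rewrite /rho.
  have h2 := q2 i; have h0 : 0 < (q i)%:R :> R by lra.
  by field; rewrite !lt0r_neq0 // subr_gt0.
rewrite Gs in laQ.
pose Z n := [set i | (q i %| n * (n + h))%N].
pose cnt (A : {set I}) : R := (\sum_(n < Y | A \subset Z n) 1)%N%:R.
(* Since [la set0 = 1], the square of the sum of [la D] over [D \subset Z n] is [1] when no prime of
   [s] divides [n * (n + h)], and is nonnegative otherwise. *)
have sieve : (\sum_(n < Y | all (fun q => ~~ (q %| n * (n + h))%N) s) 1)%N%:R <=
   \sum_D \sum_E la D * la E * cnt (D :|: E).
  rewrite natr_sum.
  apply: (@le_trans _ _ (\sum_(n < Y) (\sum_(D : {set I} | D \subset Z n) la D) ^+ 2)).
    rewrite big_mkcond ler_sum // => n _; case: ifP => [/allP sn|_]; last exact: sqr_ge0.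
    have -> : Z n = set0.
      apply/setP => i; rewrite !inE; apply/negbTE/sn; exact: valP.
    by under eq_bigl => D do rewrite subset0; rewrite big_pred1_eq la0 expr1n.
  rewrite le_eqVlt; apply/orP; left; apply/eqP.
  transitivity (\sum_(n < Y) \sum_D \sum_E
      (if D :|: E \subset Z n then la D * la E else 0)).
    apply: eq_bigr => n _; rewrite expr2 mulr_suml big_mkcond.
    apply: eq_bigr => D _; case: ifP => DZ; last first.
      by rewrite big1 // => E _; rewrite subUset DZ.
    rewrite mulr_sumr big_mkcond; apply: eq_bigr => E _.
    by rewrite subUset DZ.
  rewrite exchange_big; apply: eq_bigr => D _; rewrite exchange_big.
  apply: eq_bigr => E _; rewrite -big_mkcond /cnt natr_sum mulr_sumr.
  by apply: eq_bigr => n _; rewrite mulr1.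
apply: (le_trans sieve).
have main : \sum_D \sum_E la D * la E * (Y%:R * \prod_(i in D :|: E) rho i) =
    Y%:R / sqfsum (fun q => 2 / (q%:R - 2)) s z.
  rewrite -laQ mulr_sumr; apply: eq_bigr => D _; rewrite mulr_sumr.
  by apply: eq_bigr => E _; rewrite mulrCA.
rewrite -main addrC -lerBlDr -sumrB.
rewrite natrX.
have lz (D : {set I}) : D \in DD -> `|la D| <= z%:R.
  rewrite inE => Dz; apply: (le_trans (lab D)).
  apply: (@le_trans _ _ (\prod_(i in D) (q i)%:R)); last by rewrite -natr_prod ler_nat.
  rewrite ler_prod // => i _; rewrite /rho invf_div.
  by have := q2 i => h2; rewrite divr_ge0 ?ler0n //= ler_pdivrMr //; lra.
(* The error [2 ^ #|D :|: E|] is at most the product of the primes in the union, hence at most the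
   product of the two integers attached to [D] and [E]. *)
have ez (D E : {set I}) : D \in DD -> E \in DD ->
    `|cnt (D :|: E) - Y%:R * \prod_(i in D :|: E) rho i| <= z%:R ^+ 2.
  move=> DDD EDD; apply: le_trans (count_dvd_pair_error _ _ _ qinj _) _.
    by move=> i; case: (qp i) => -> _ ->.
  rewrite -prodr_const.
  apply: (@le_trans _ _ (\prod_(i in D :|: E) (q i)%:R)).
    by rewrite ler_prod // => i _; rewrite ler0n /= ltW.
  rewrite -natr_prod -natrX ler_nat.
  move: DDD EDD; rewrite !inE => Dz Ez.
  apply: (@leq_trans ((\prod_(i in D) q i) * (\prod_(i in E) q i))); last exact: leq_mul.
  rewrite (big_setID (A := D :|: E) E) /= (setIidPr (subsetUr D E)) mulnC leq_mul2r.
  rewrite setDUl setDv setU0 [leqRHS](big_setID E) /= leq_pmull ?orbT //.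
  by rewrite prodn_cond_gt0 // => i _; rewrite prime_gt0.
apply: (@le_trans _ _ (\sum_(D in DD) \sum_(E in DD) z%:R ^+ 4)).
  rewrite [leRHS]big_mkcond ler_sum // => D _; rewrite -sumrB.
  case: ifP => DDD; last first.
    by rewrite big1 // => E _; rewrite laDD ?DDD // !mul0r subrr.
  rewrite [leRHS]big_mkcond ler_sum // => E _; rewrite -mulrBr.
  case: ifP => EDD; last by rewrite [la E]laDD ?EDD // mulr0 mul0r.
  apply: (le_trans (ler_norm _)); rewrite !normrM.
  have -> : z%:R ^+ 4 = z%:R * z%:R * z%:R ^+ 2 :> R by ring.
  by rewrite !ler_pM ?mulr_ge0 ?normr_ge0 ?lz ?ez.
rewrite !sumr_const -mulrnA -[leLHS]mulr_natl natrM.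
have -> : z%:R ^+ 6 = z%:R * z%:R * z%:R ^+ 4 :> R by ring.
rewrite ler_wpM2r ?exprn_ge0 // -!natrM ler_nat.
by rewrite leq_mul //; apply: card_prime_prod_le.
Qed.

From mathcomp Require Import all_classical all_reals all_analysis.
Import numFieldNormedType.Exports.

(** * Lower bound for the main term of the sieve *)

Lemma harmonic_pow2_ge (R : realFieldType) (j : nat) :
  j%:R / 2 <= \sum_(1 <= n < (2 ^ j).+1) (n%:R^-1 : R).
Proof.
elim: j => [|j IHj]; first by rewrite mul0r sumr_ge0 // => n _; rewrite invr_ge0.
rewrite (@big_cat_nat _ _ _ (2 ^ j).+1) //=; last by rewrite ltnS leq_exp2l.
rewrite -natr1 mulrDl lerD //.
(* The [2 ^ j] new terms are each at least [1 / 2 ^ j.+1], so the block contributes at least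
   [1/2]. *)
apply: (@le_trans _ _ (\sum_((2 ^ j).+1 <= n < (2 ^ j.+1).+1) (2 ^ j.+1)%:R^-1)).
  rewrite sumr_const_nat subSS expnS mul2n -addnn addnK -[leRHS]mulr_natl.
  by rewrite addnn -mul2n natrM invfM mulrCA divff ?mulr1 ?mul1r // pnatr_eq0 expn_eq0.
rewrite ler_sum_nat // => n /andP[n0 n1].
by rewrite lef_pV2 ?posrE ?ltr0n ?expn_gt0 // ?ler_nat //; apply: leq_trans n0.
Qed.

Definition primes_upto (w : nat) := [seq p <- index_iota 1 w.+1 | prime p].

Lemma mem_primes_upto (w p : nat) : (p \in primes_upto w) = prime p && (p <= w)%N.
Proof.
rewrite mem_filter mem_index_iota ltnS; case: (boolP (prime p)) => //= pp.
by rewrite prime_gt0.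
Qed.

Lemma harmonic_le_sqfsum (R : realFieldType) (w : nat) :
  \sum_(1 <= n < w.+1) (n%:R^-1 : R) <=
  sqfsum (fun p => (p.-1)%:R^-1) (primes_upto w) w.
Proof.
apply: le_trans (smooth_harmonic_le_sqfsum R w _); last first.
  by move=> p; rewrite mem_primes_upto => /andP[].
rewrite [leRHS]big_mkcond ler_sum_nat // => n /andP[n0 nw].
rewrite ifT //; apply/allP => q; rewrite mem_primes inE mem_primes_upto.
by move=> /and3P[-> _ qn] /=; rewrite -ltnS; apply: leq_ltn_trans nw; apply: dvdn_leq.
Qed.

(** At [2] the density [2/q] would not be below [1], and a prime dividing [h] removes one residue
    class instead of two; both are left out. *)
Definition pair_primes (w h : nat) :=
  [seq p <- primes_upto w | (2 < p)%N && ~~ (p %| h)%N].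

(* Bounds the factor lost in the main term by not sieving with the primes dividing [h]. *)
Definition sieve_loss (R : realFieldType) (w h : nat) : R :=
  \prod_(p <- primes_upto w | (p %| h)%N) (1 + (p.-1)%:R^-1).

Lemma sieve_loss_ge1 (R : realFieldType) (w h : nat) : 1 <= sieve_loss R w h.
Proof.
rewrite /sieve_loss; elim/big_rec: _ => // p x _ x1.
by apply: mulr_ege1 => //; rewrite lerDl invr_ge0 ler0n.
Qed.

(** The harmonic sum up to [2 ^ j] is at least [j/2]. Omitting the prime [2] costs a factor [2] and
    omitting the divisors of [h] costs [sieve_loss]; squaring then passes from the coefficients
    [1/(p - 1)] to [2/(p - 2)] and from level [w] to [w * w]. *)
Lemma pair_sqfsum_ge (R : realFieldType) (j h : nat) :
  (j%:R / 4) ^+ 2 <= sieve_loss R (2 ^ j) h ^+ 2 *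
    sqfsum (fun q => 2 / (q%:R - 2)) (pair_primes (2 ^ j) h) (2 ^ j * 2 ^ j).
Proof.
set w := (2 ^ j)%N.
pose f (p : nat) : R := (p.-1)%:R^-1.
have f0 p : 0 <= f p by rewrite invr_ge0 ler0n.
set a := fun p => (2 < p)%N && ~~ (p %| h)%N.
have Fs : sqfsum f (primes_upto w) w <= (2 * sieve_loss R w h) * sqfsum f (pair_primes w h) w.
  apply: (le_trans (@sqfsum_filter _ f a _ _ _)) => //.
  rewrite ler_wpM2r ?sqfsum_ge0 //.
  (* When [h] is even the factor of the prime [2] is counted twice, which is harmless as all factors
     are at least [1]. *)
  apply: (@le_trans _ _ ((\prod_(p <- primes_upto w | p == 2%N) (1 + f p)) * sieve_loss R w h)).
    rewrite [X in X * _]big_mkcond [X in _ * X]big_mkcond -big_split /=.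
    rewrite [leLHS]big_mkcond /= big_seq [leRHS]big_seq ler_prod // => p.
    rewrite mem_primes_upto => /andP[pp _].
    have h1 : 1 <= 1 + f p by rewrite lerDl.
    rewrite (_ : ~~ a p = (p == 2%N) || (p %| h)%N).
      case: eqP; case: (p %| h)%N => _ /=; rewrite ?mul1r ?mulr1 //.
      - by rewrite (le_trans ler01) //= ler_peMl // (le_trans ler01).
      - by rewrite (le_trans ler01) /=.
      - by rewrite (le_trans ler01) /=.
      - by rewrite ler01 /=.
    rewrite /a negb_and negbK -leqNgt; congr (_ || _).
    by rewrite eqn_leq (prime_gt1 pp) andbT.
  rewrite ler_wpM2r ?(le_trans ler01 (sieve_loss_ge1 _ _ _)) //.
  rewrite -big_filter; have : uniq [seq p <- primes_upto w | p == 2%N].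
    by rewrite !filter_uniq ?iota_uniq.
  have : forall p, p \in [seq p <- primes_upto w | p == 2%N] -> p = 2%N.
    by move=> p; rewrite mem_filter => /andP[/eqP].
  case: [seq p <- _ | _] => [|p [|q t]] ms /=.
  - by rewrite big_nil ler1n.
  - by rewrite big_seq1 (ms p (mem_head _ _)) /f /= invr1.
  - by rewrite inE (ms p (mem_head _ _)) (ms q) ?inE ?eqxx ?orbT.
have F2 : sqfsum f (pair_primes w h) w ^+ 2 <=
    sqfsum (fun q => 2 / (q%:R - 2)) (pair_primes w h) (w * w).
  rewrite expr2 sqfsum_mul // => p; rewrite mem_filter mem_primes_upto.
    by move=> /andP[_ /andP[pp _]]; rewrite prime_gt0.
  move=> /andP[/andP[p2 _] /andP[pp _]]; rewrite /f.
  have p2R : 2 < p%:R :> R by rewrite ltr_nat.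
  have -> : p.-1%:R = p%:R - 1 :> R.
    by rewrite -[in RHS](prednK (prime_gt0 pp)) -natr1 addrK.
  have h1 : 0 < p%:R - 1 :> R by lra.
  have h2 : 0 < p%:R - 2 :> R by lra.
  rewrite -subr_ge0.
  have -> : 2 / (p%:R - 2) - (2 * (p%:R - 1)^-1 + (p%:R - 1)^-1 ^+ 2) =
      p%:R / ((p%:R - 2) * (p%:R - 1) ^+ 2) :> R.
    by field; rewrite !lt0r_neq0.
  by rewrite divr_ge0 ?ler0n // mulr_ge0 ?exprn_ge0 // ltW.
have h1 := le_trans (harmonic_pow2_ge R j) (le_trans (harmonic_le_sqfsum R w) Fs).
apply: (@le_trans _ _ ((sieve_loss R w h * sqfsum f (pair_primes w h) w) ^+ 2)).
  rewrite ler_pXn2r ?nnegrE ?divr_ge0 ?ler0n ?mulr_ge0 ?sqfsum_ge0 //; last first.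
    by apply: le_trans ler01 (sieve_loss_ge1 _ _ _).
  by move: h1; rewrite -mulrA; set t := sieve_loss _ _ _ * _ => *; lra.
by rewrite exprMn ler_wpM2l ?sqr_ge0.
Qed.

(** Selberg's bound at level [z = 2 ^ (2 * j)]: the remainder [z ^ 6] is [2 ^ (12 * j)], and [16]
    comes from [(j / 4) ^+ 2]. *)
Lemma pair_count_le (R : realFieldType) (j h Y : nat) : (0 < j)%N ->
  (\sum_(n < Y | all (fun q => ~~ (q %| n * (n + h))%N) (pair_primes (2 ^ j) h)) 1)%N%:R <=
  16 * Y%:R * sieve_loss R (2 ^ j) h ^+ 2 / j%:R ^+ 2 + (2 ^ (12 * j))%:R :> R.
Proof.
move=> j0; set w := (2 ^ j)%N; have w0 : (0 < w * w)%N by rewrite muln_gt0 expn_gt0.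
apply: (le_trans (selberg_pair_bound _ _ _ _ w0)).
- by rewrite !filter_uniq ?iota_uniq.
- move=> q; rewrite mem_filter mem_primes_upto => /andP[/andP[q2 qh] /andP[qp _]].
  by split.
rewrite lerD //; last by rewrite ler_nat -expnD -expnM leq_exp2l //; lia.
have := pair_sqfsum_ge R j h; rewrite -/w; set G := sqfsum _ _ _; set b := sieve_loss _ _ _.
have jR : 0 < j%:R :> R by rewrite ltr0n.
have b1 : 1 <= b by apply: sieve_loss_ge1.
have b2 : 0 < b ^+ 2 by rewrite exprn_gt0 // (lt_le_trans ltr01).
move=> hG.
have G0 : 0 < G.
  rewrite -(pmulr_rgt0 _ b2); apply: lt_le_trans hG.
  by rewrite exprn_gt0 // divr_gt0.
have h16 : 1 <= 16 * (b ^+ 2 * G) / j%:R ^+ 2.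
  rewrite ler_pdivlMr ?exprn_gt0 // mul1r.
  have e4 : (j%:R / 4) ^+ 2 = j%:R ^+ 2 / 16 :> R by field.
  by move: hG; rewrite e4; set t := b ^+ 2 * G; set u := j%:R ^+ 2 => *; lra.
rewrite ler_pdivrMr //.
have -> : 16 * Y%:R * b ^+ 2 / j%:R ^+ 2 * G = Y%:R * (16 * (b ^+ 2 * G) / j%:R ^+ 2).
  by field; rewrite lt0r_neq0.
by rewrite ler_peMr.
Qed.

(** * Average of the arithmetic factor over the shifts *)

Lemma mean_local_factors_le (R : realFieldType) (u : nat -> R) (s : seq nat) (H : nat) :
  uniq s -> {in s, forall p, prime p /\ 0 <= u p} ->
  \sum_(1 <= h < H.+1) \prod_(p <- s | (p %| h)%N) (1 + u p) <=
  H%:R * \prod_(p <- s) (1 + u p / p%:R).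
Proof.
elim: s H => [|p s IHs] H /=.
  move=> _ _; under eq_bigr do rewrite big_nil.
  by rewrite sumr_const_nat subn1 big_nil mulr1.
move=> /andP[ps us] sp.
have sp' : {in s, forall q, prime q /\ 0 <= u q} by move=> q qs; apply: sp; rewrite inE qs orbT.
have [pp up] := sp p (mem_head _ _).
have p0 := prime_gt0 pp; have pR : 0 < p%:R :> R by rewrite ltr0n.
pose B h := \prod_(q <- s | (q %| h)%N) (1 + u q).
(* The extra factor [u p] appears on the multiples [p * h] only, and a prime [q] of [s] differs from
   [p], so it divides [p * h] exactly when it divides [h]. *)
have -> : \sum_(1 <= h < H.+1) \prod_(q <- p :: s | (q %| h)%N) (1 + u q) =
    \sum_(1 <= h < H.+1) B h + u p * \sum_(1 <= h < (H %/ p)%N.+1) B h.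
  transitivity (\sum_(1 <= h < H.+1) (B h + (if (p %| h)%N then u p * B h else 0))).
    apply: eq_bigr => h _; rewrite big_cons; case: ifP => _; last by rewrite addr0.
    by rewrite mulrDl mul1r.
  rewrite big_split /= -big_mkcond sum_dvd_reindex // mulr_sumr; congr (_ + _).
  apply: eq_bigr => h _; congr (_ * _); rewrite /B big_seq_cond [RHS]big_seq_cond.
  apply: eq_bigl => q; case: (boolP (q \in s)) => //= qs.
  have [pq _] := sp' q qs; rewrite Euclid_dvdM // dvdn_prime2 //.
  by case: eqP => //= qp; rewrite -qp qs in ps.
have P0 : 0 <= \prod_(q <- s) (1 + u q / q%:R).
  by rewrite big_seq prodr_ge0 // => q /sp'[_ uq]; rewrite addr_ge0 ?divr_ge0.
rewrite big_cons mulrCA mulrDl mul1r lerD ?IHs //.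
rewrite -mulrA ler_wpM2l //; apply: (le_trans (IHs _ us sp')).
rewrite mulrA ler_wpM2r // mulrC ler_pdivlMr // -natrM ler_nat.
exact: leq_trunc_div.
Qed.

(** With [x = 1/(p - 1) <= 1], the bound [(1 + x)^2 - 1 <= 3 x] makes each factor at most the
    exponential of [3/(p - 1) - 3/p]. These exponents telescope over all integers, so for [w > 0]
    the induction proves the sharper exponent [3 - 3/w]. *)
Lemma prod_prime_loss_le (R : realType) (w : nat) :
  \prod_(p <- primes_upto w) (1 + ((1 + (p.-1)%:R^-1) ^+ 2 - 1) / p%:R) <= expR (3 : R).
Proof.
case: w => [|w]; first by rewrite /primes_upto /= big_nil -[leLHS]expR0 ler_expR.
apply: (@le_trans _ _ (expR (3 - 3 / w.+1%:R))); last first.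
  by rewrite ler_expR gerBl divr_ge0.
rewrite big_filter; elim: w => [|w IHw].
  by rewrite big_mkcond big_nat1 (_ : 3 - 3 / 1 = 0) ?expR0 //; field.
rewrite big_mkcond big_nat_recr //= -big_mkcond /=.
have w1 : 1 <= w.+1%:R :> R by rewrite ler1n.
have -> : 3 - 3 / w.+2%:R = (3 - 3 / w.+1%:R) + 3 / (w.+1%:R * w.+2%:R) :> R.
  rewrite -[w.+2%:R]natr1; field; rewrite !lt0r_neq0 //; lra.
rewrite expRD ler_pM //.
- by apply: prodr_ge0 => p _; rewrite addr_ge0 // divr_ge0 // subr_ge0 exprn_ege1 // lerDl.
- by case: ifP => // _; rewrite addr_ge0 // divr_ge0 // subr_ge0 exprn_ege1 // lerDl.
case: ifP => _; last by rewrite -[leLHS]expR0 ler_expR divr_ge0 // mulr_ge0.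
apply: le_trans (expR_ge1Dx _); rewrite lerD2l invfM mulrA ler_wpM2r //.
set x := w.+1%:R^-1; have x1 : x <= 1 by rewrite invf_le1 ?ltr0n.
have x0 : 0 <= x by rewrite invr_ge0.
by rewrite expr2; nra.
Qed.

Lemma mean_sieve_loss_le (R : realType) (w H : nat) :
  \sum_(1 <= h < H.+1) sieve_loss R w h ^+ 2 <= H%:R * expR 3.
Proof.
pose u (p : nat) : R := (1 + (p.-1)%:R^-1) ^+ 2 - 1.
have u0 p : 0 <= u p by rewrite subr_ge0 exprn_ege1 // lerDl invr_ge0.
apply: (@le_trans _ _ (H%:R * \prod_(p <- primes_upto w) (1 + u p / p%:R))); last first.
  by rewrite ler_wpM2l // prod_prime_loss_le.
have sqE h : sieve_loss R w h ^+ 2 = \prod_(p <- primes_upto w | (p %| h)%N) (1 + u p).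
  rewrite -prodrXl; apply: eq_bigr => p _.
  by rewrite [RHS]addrC /u subrK.
rewrite (eq_bigr _ (fun h _ => sqE h)).
apply: mean_local_factors_le; first by rewrite filter_uniq ?iota_uniq.
by move=> p; rewrite mem_primes_upto => /andP[].
Qed.

(** * Dyadic blocks *)

Lemma next_primeP (n : nat) : prime (next_prime n) /\ (n < next_prime n)%N.
Proof. by rewrite /next_prime; case: ex_minnP => p /andP[]. Qed.

(** A prime [n] is counted on the right at [h] equal to its own gap: [n] and [n + h] are primes
    above [2 ^ j], so no sieving prime divides either. *)
Lemma short_gap_count_le_pair_count (m j H : nat) : (j < m)%N ->
  (\sum_(2 ^ m <= p < 2 ^ m.+1 | prime p && (next_prime p <= p + H)) 1 <=
   \sum_(1 <= h < H.+1) \sum_(n < 2 ^ m.+1 |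
      all (fun q => ~~ (q %| n * (n + h))) (pair_primes (2 ^ j) h)) 1)%N.
Proof.
move=> jm; rewrite (big_nat_widenl _ 0%N) // big_mkord.
under [leqRHS]eq_bigr do rewrite big_mkcond.
rewrite exchange_big big_mkcond; apply: leq_sum => n _.
case: ifP => // /andP[/andP[pn nH] mn].
have [pn' nn'] := next_primeP n.
have hin : (next_prime n - n)%N \in index_iota 1 H.+1.
  by rewrite mem_index_iota subn_gt0 nn' ltnS leq_subLR.
rewrite (bigD1_seq _ hin (iota_uniq _ _)) /= ifT // subnKC; last exact: ltnW.
apply/allP => q; rewrite mem_filter mem_primes_upto => /and3P[_ pq qw].
have qn : (q < n)%N by apply: leq_ltn_trans qw (leq_trans _ mn); rewrite ltn_exp2l.
rewrite Euclid_dvdM // !dvdn_prime2 // negb_or !neq_ltn qn.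
by rewrite (ltn_trans qn nn').
Qed.

(* [expR 3] is the bound of [prod_prime_loss_le]; 784 = 28 ^ 2 comes from
   [m <= 28 * (m %/ 14)]. *)
Definition gap_const (R : realType) : R := 784 * (32 * expR 3 + 1).

Lemma gap_const_gt0 (R : realType) : 0 < gap_const R.
Proof. by rewrite /gap_const; have := expR_gt0 (3 : R) => ?; lra. Qed.

(** With [j = m %/ 14] one has [2 ^ (12 * j) * j ^ 2 <= 2 ^ (14 * j) <= 2 ^ m], so for each [h] the
    remainder is at most [2 ^ m / j ^ 2], the order of the main term. The mean bound on the squared
    loss gives the factor [H]. *)
Lemma short_gap_count_le (R : realType) (m H : nat) : (14 <= m)%N ->
  (\sum_(2 ^ m <= p < 2 ^ m.+1 | prime p && (next_prime p <= p + H)) 1)%N%:R <=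
  gap_const R * H%:R * 2 ^+ m / m%:R ^+ 2.
Proof.
move=> m14; pose j := (m %/ 14)%N.
have j0 : (0 < j)%N by rewrite divn_gt0.
have jm : (j < m)%N by rewrite ltn_Pdiv //; apply: leq_trans m14.
have := short_gap_count_le_pair_count H jm.
rewrite -(ler_nat R) => /le_trans -> //; rewrite natr_sum.
apply: (@le_trans _ _ (\sum_(1 <= h < H.+1) (16 * (2 ^ m.+1)%:R / j%:R ^+ 2 *
    sieve_loss R (2 ^ j) h ^+ 2 + (2 ^ (12 * j))%:R))).
  apply: ler_sum => h _; apply: le_trans (pair_count_le _ _ _ j0) _.
  by rewrite lerD2r mulrAC.
rewrite big_split /= -mulr_sumr sumr_const_nat subn1 /=.
have jR : 1 <= j%:R :> R by rewrite ler1n.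
have mR : 14 <= m%:R :> R by rewrite ler_nat.
have e3 : 0 <= expR 3 :> R := expR_ge0 3.
have A0 : 0 <= 16 * (2 ^ m.+1)%:R / j%:R ^+ 2 :> R by rewrite divr_ge0 ?mulr_ge0 ?exprn_ge0.
have h1 := ler_wpM2l A0 (mean_sieve_loss_le R (2 ^ j) H).
have h2 : (2 ^ (12 * j))%:R <= 2 ^+ m / j%:R ^+ 2 :> R.
  rewrite ler_pdivlMr ?exprn_gt0 ?ltr0n // -!natrX -natrM ler_nat.
  apply: (@leq_trans (2 ^ (12 * j) * (2 ^ j) ^ 2)).
    by rewrite leq_mul2l leq_exp2r // ltnW ?orbT // ltn_expl.
  by rewrite -expnM -expnD leq_exp2l //; have := leq_trunc_div m 14; rewrite -/j; lia.
have h3 : (j%:R ^+ 2)^-1 <= 784 / m%:R ^+ 2 :> R.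
  rewrite ler_pdivlMr ?exprn_gt0 ?(lt_le_trans _ mR) // mulrC ler_pdivrMr ?exprn_gt0 ?ltr0n //.
  have -> : 784 * j%:R ^+ 2 = (28 * j%:R) ^+ 2 :> R by ring.
  rewrite ler_pXn2r ?nnegrE ?mulr_ge0 // -natrM ler_nat.
  by have := ltn_ceil m (isT : (0 < 14)%N); rewrite -/j; lia.
apply: le_trans (lerD h1 _) _; first exact: ler_wMn2r h2.
rewrite /gap_const natrX exprS -[X in _ + X <= _]mulr_natl.
have H0 : 0 <= H%:R :> R by [].
have X0 : 0 <= 2 ^+ m :> R by rewrite exprn_ge0.
set X := 2 ^+ m in X0 *; set J := (j%:R ^+ 2)^-1 in h3 *; set M := (m%:R ^+ 2)^-1 in h3 *.
have -> : 16 * (2 * X) * J * (H%:R * expR 3) + H%:R * (X * J) =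
   (32 * expR 3 + 1) * H%:R * X * J by ring.
have -> : 784 * (32 * expR 3 + 1) * H%:R * X * M =
   (32 * expR 3 + 1) * H%:R * X * (784 * M) by ring.
by rewrite ler_wpM2l // !mulr_ge0 // addr_ge0 // mulr_ge0.
Qed.

Lemma short_gap_block_le (R : realType) (m : nat) (x : R) : (14 <= m)%N -> 0 <= x ->
  \sum_(2 ^ m <= p < 2 ^ m.+1 | prime p && ((next_prime p)%:R - p%:R <= x)) 1 / p%:R <=
  gap_const R * x / m%:R ^+ 2.
Proof.
move=> m14 x0; pose H := Num.truncn x.
have X0 : 0 < 2 ^+ m :> R by rewrite exprn_gt0.
apply: (@le_trans _ _ (\sum_(2 ^ m <= p < 2 ^ m.+1 | prime p && (next_prime p <= p + H)%N)
    (2 ^+ m)^-1)).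
  rewrite big_mkcond [leRHS]big_mkcond ler_sum_nat // => p /andP[mp _].
  have [_ pn] := next_primeP p.
  (* Gaps are integers, so [x] may be replaced by its integer part. *)
  have -> : ((next_prime p)%:R - p%:R <= x) = (next_prime p <= p + H)%N.
    by rewrite -natrB ?(ltnW pn) // -truncn_ge_nat // leq_subLR.
  case: ifP => // _; rewrite div1r lef_pV2 ?posrE //; first by rewrite -natrX ler_nat.
  by rewrite ltr0n; apply: leq_trans mp; rewrite expn_gt0.
have -> : \sum_(2 ^ m <= p < 2 ^ m.+1 | prime p && (next_prime p <= p + H)%N) (2 ^+ m)^-1 =
   (\sum_(2 ^ m <= p < 2 ^ m.+1 | prime p && (next_prime p <= p + H)) 1)%N%:R / 2 ^+ m :> R.
  by rewrite natr_sum mulr_suml; apply: eq_bigr => p _; rewrite mul1r.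
rewrite ler_pdivrMr //; apply: le_trans (short_gap_count_le _ _ m14) _.
rewrite mulrAC ler_wpM2r ?(ltW X0) // ler_wpM2r ?invr_ge0 ?exprn_ge0 //.
rewrite ler_wpM2l ?truncn_le //.
exact: ltW (gap_const_gt0 R).
Qed.

(** * Iterated logarithms and summation over blocks *)

Lemma iter_expR1_ge1 (R : realType) (n : nat) : 1 <= iter n (@expR R) 1.
Proof.
elim: n => //= n IHn; rewrite -[leLHS]expR0 ler_expR.
exact: le_trans ler01 IHn.
Qed.

(** The exponential tower of height [k] serves as threshold: beyond it the iterated logarithms up to
    the [k]-th are at least [1], hence positive and increasing. *)
Lemma iter_ln_ge (R : realType) (k i : nat) (t : R) : iter k (@expR R) 1 <= t ->
  (i <= k)%N -> iter (k - i) (@expR R) 1 <= iter_ln i t.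
Proof.
move=> tk; elim: i => [|i IHi] ik; first by rewrite subn0.
have := IHi (ltnW ik); rewrite -(subnSK ik) /= => IH.
rewrite -[leLHS]expRK ler_ln ?posrE ?expR_gt0 //.
exact: lt_le_trans (expR_gt0 _) IH.
Qed.

Lemma iter_ln_ge1 (R : realType) (k i : nat) (t : R) : iter k (@expR R) 1 <= t ->
  (i <= k)%N -> 1 <= iter_ln i t.
Proof. by move=> tk ik; apply: le_trans (iter_expR1_ge1 _ _) (iter_ln_ge tk ik). Qed.

Lemma le_iter_ln (R : realType) (k i : nat) (a b : R) : iter k (@expR R) 1 <= a ->
  a <= b -> (i <= k)%N -> iter_ln i a <= iter_ln i b.
Proof.
move=> ka ab; elim: i => [//|i IHi] ik.
have a1 := iter_ln_ge1 ka (ltnW ik); have b1 := iter_ln_ge1 (le_trans ka ab) (ltnW ik).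
by rewrite /= ler_ln ?posrE ?(lt_le_trans ltr01) ?IHi // ltnW.
Qed.

Lemma ln_sub_ge (R : realType) (a b : R) : 0 < a -> 0 < b -> (b - a) / b <= ln b - ln a.
Proof.
move=> a0 b0; rewrite -[leRHS]opprB lerNr -ln_div ?posrE //.
have := @expR_ge1Dx R (ln (a / b)); rewrite lnK ?posrE ?divr_gt0 // => h.
have -> : - ((b - a) / b) = a / b - 1 by field; rewrite lt0r_neq0.
by rewrite lerBrDl.
Qed.

(** Discrete form of the derivative of the iterated logarithm with respect to [ln], taken at the
    right endpoint where it is smallest; each induction step applies [ln_sub_ge] once. *)
Lemma iter_ln_sub_ge (R : realType) (k i : nat) (a b : R) : iter k (@expR R) 1 <= a ->
  a <= b -> (i <= k)%N ->
  (ln b - ln a) / \prod_(1 <= j < i.+1) iter_ln j b <= iter_ln i.+1 b - iter_ln i.+1 a.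
Proof.
move=> ka ab; elim: i => [|i IHi] ik; first by rewrite big_geq // divr1.
have a1 := iter_ln_ge1 ka ik; have b1 := iter_ln_ge1 (le_trans ka ab) ik.
have b0 := lt_le_trans ltr01 b1.
apply: le_trans (ln_sub_ge (lt_le_trans ltr01 a1) b0).
rewrite big_nat_recr //= invfM mulrA ler_wpM2r ?invr_ge0 ?(ltW b0) //.
exact: IHi (ltnW ik).
Qed.

(** With [d = eps * (ln b - ln a)], the first power on the right is [expR d] times the second, and
    [expR d - 1 >= d]. *)
Lemma powRN_sub_ge (R : realType) (eps a b : R) : 0 < a -> 0 < b -> 0 < eps ->
  eps * (ln b - ln a) * b `^ (- eps) <= a `^ (- eps) - b `^ (- eps).
Proof.
move=> a0 b0 e0; rewrite /powR !gt_eqF //.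
have -> : - eps * ln a = eps * (ln b - ln a) + - eps * ln b by ring.
rewrite expRD; set E := expR (- eps * ln b).
have E0 : 0 <= E by apply: expR_ge0.
have := expR_ge1Dx (eps * (ln b - ln a)); set d := eps * _ => hd.
by rewrite -{3}[E]mul1r -mulrBl ler_wpM2r // lerBrDl.
Qed.

(* The iterated logarithm antiderivative: [(log_k t)^-eps] has derivative
   [- eps * lambda k eps t / (t * log t)]. *)
Lemma lambda_telescope (R : realType) (k : nat) (eps a b : R) : (0 < k)%N -> 0 < eps ->
  iter k (@expR R) 1 <= a -> a <= b ->
  eps * (ln b - ln a) * lambda k eps b / ln b <=
  iter_ln k a `^ (- eps) - iter_ln k b `^ (- eps).
Proof.
move=> k0 e0 ka ab; have kb := le_trans ka ab.
have Ka : 0 < iter_ln k a := lt_le_trans ltr01 (iter_ln_ge1 ka (leqnn _)).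
have Kb : 0 < iter_ln k b := lt_le_trans ltr01 (iter_ln_ge1 kb (leqnn _)).
apply: le_trans (powRN_sub_ge Ka Kb e0).
(* At [i = k] the right side is the increment of the logarithm of [iter_ln k], and the product is
   [ln b * Log k b]. *)
have := iter_ln_sub_ge ka ab (leqnn k); rewrite /= => h.
rewrite /lambda /Log powRN.
rewrite big_nat_recl //= in h.
have -> : \prod_(2 <= j < k.+1) iter_ln j b = \prod_(1 <= j < k) iter_ln j.+1 b.
  by rewrite big_add1.
rewrite /= in h; set P := \prod_(1 <= j < k) _ in h *.
have -> : eps * (ln b - ln a) * (1 / (P * iter_ln k b `^ eps)) / ln b =
   eps * ((ln b - ln a) / (ln b * P)) * (iter_ln k b `^ eps)^-1.
  by rewrite !invfM mul1r; ring.
by rewrite ler_wpM2r ?invr_ge0 ?powR_ge0 // ler_wpM2l ?(ltW e0).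
Qed.

Lemma lambda_ge0 (R : realType) (k : nat) (eps t : R) : iter k (@expR R) 1 <= t ->
  0 <= lambda k eps t.
Proof.
move=> kt; rewrite /lambda /Log divr_ge0 // mulr_ge0 ?powR_ge0 //.
rewrite big_nat_cond prodr_ge0 // => j; rewrite andbT => /andP[_ jk].
exact: le_trans ler01 (iter_ln_ge1 kt jk).
Qed.

Lemma lambda_anti (R : realType) (k : nat) (eps a b : R) : 0 <= eps ->
  iter k (@expR R) 1 <= a -> a <= b -> lambda k eps b <= lambda k eps a.
Proof.
move=> e0 ka ab; have kb := le_trans ka ab; rewrite /lambda !div1r.
have pos t : iter k (@expR R) 1 <= t -> 0 < Log k t.
  move=> kt; rewrite /Log big_nat_cond prodr_gt0 // => j; rewrite andbT => /andP[_ jk].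
  exact: lt_le_trans ltr01 (iter_ln_ge1 kt jk).
have kpos t : iter k (@expR R) 1 <= t -> 0 < iter_ln k t.
  by move=> kt; apply: lt_le_trans ltr01 (iter_ln_ge1 kt (leqnn _)).
rewrite lef_pV2 ?posrE ?mulr_gt0 ?powR_gt0 ?pos ?kpos //.
rewrite ler_pM ?powR_ge0 ?(ltW (pos _ _)) //; last first.
  by rewrite ge0_ler_powR ?nnegrE ?(ltW (kpos _ _)) //; apply: le_iter_ln ka ab _.
rewrite /Log big_nat_cond [leRHS]big_nat_cond ler_prod // => j; rewrite andbT => /andP[_ jk].
by rewrite (le_trans ler01 (iter_ln_ge1 ka jk)) /=; apply: le_iter_ln ka ab jk.
Qed.

Definition small_gap_prime (R : realType) (k : nat) (eps : R) (p : nat) : bool :=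
  [&& prime p, iter_ln_pos k (p%:R : R)
    & (next_prime p)%:R - p%:R <= lambda k eps p%:R * ln (p%:R : R)].

(** The block starting at [b = 2 ^+ m.+1] is charged to the increment over the preceding block. As
    [lambda] decreases, its values on the block are at most [lambda k eps b], the value that
    [lambda_telescope] supplies at its right endpoint. *)
Lemma small_gap_block_le (R : realType) (k m : nat) (eps : R) : (0 < k)%N -> 0 < eps ->
  (14 <= m)%N -> iter k (@expR R) 1 <= 2 ^+ m ->
  \sum_(2 ^ m.+1 <= p < 2 ^ m.+2 | small_gap_prime k eps p) 1 / p%:R <=
  2 * gap_const R / eps *
    (iter_ln k (2 ^+ m) `^ (- eps) - iter_ln k (2 ^+ m.+1) `^ (- eps)).
Proof.
move=> k0 e0 m14 km; set b : R := 2 ^+ m.+1.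
have ab : 2 ^+ m <= b by rewrite /b exprS ler_peMl ?exprn_ge0 // ler1n.
have kb := le_trans km ab.
have l0 := lambda_ge0 eps kb.
have ln2 : 0 < ln (2 : R) by rewrite ln_gt0 // ltr1n.
have lnb n : ln (2 ^+ n : R) = n%:R * ln 2 by rewrite lnXn // mulr_natl.
pose x : R := lambda k eps b * (m.+2%:R * ln 2).
have x0 : 0 <= x by apply: mulr_ge0 => //; apply: mulr_ge0 => //; exact: ltW.
apply: (@le_trans _ _ (\sum_(2 ^ m.+1 <= p < 2 ^ m.+2 |
    prime p && ((next_prime p)%:R - p%:R <= x)) 1 / p%:R)).
  rewrite big_mkcond [leRHS]big_mkcond ler_sum_nat // => p /andP[mp pm].
  case: ifP => [/and3P[pp _ gap]|_]; last by case: ifP => // _; rewrite divr_ge0.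
  rewrite pp (le_trans gap) //.
  have bp : b <= p%:R by rewrite /b -natrX ler_nat.
  have p0 : 0 < p%:R :> R by rewrite ltr0n prime_gt0.
  rewrite ler_pM ?(lambda_ge0 _ (le_trans kb bp)) ?(lambda_anti (ltW e0) kb bp) //.
    by rewrite ln_ge0 // ler1n prime_gt0.
  by rewrite -lnb ler_ln ?posrE ?exprn_gt0 // -natrX ler_nat ltnW.
apply: le_trans (short_gap_block_le (leqW m14) x0) _.
have := lambda_telescope k0 e0 km ab; rewrite /b !lnb -/b.
set d := _ `^ _ - _ => h.
have m0 : 0 < m.+1%:R :> R by [].
have c0 := gap_const_gt0 R.
(* Here [ln b - ln (2 ^+ m) = ln 2] cancels against [ln b = m.+1%:R * ln 2]. *)
have h' : eps * lambda k eps b / m.+1%:R <= d.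
  apply: le_trans h; rewrite le_eqVlt; apply/orP; left; apply/eqP.
  by rewrite -[m.+1%:R]natr1; field; rewrite !lt0r_neq0 // natr1.
have l2 : ln (2 : R) <= 1.
  by rewrite -[leRHS](expRK) ler_ln ?posrE ?expR_gt0 //; apply: le_trans (expR_ge1Dx 1).
have -> : 2 * gap_const R / eps * d = gap_const R * (2 * d / eps) by ring.
rewrite -mulrA ler_wpM2l ?(ltW c0) // ler_pdivlMr //.
have q2 : m.+2%:R * ln (2 : R) / m.+1%:R <= 2.
  rewrite ler_pdivrMr //; apply: (@le_trans _ _ m.+2%:R); first by rewrite ler_piMr.
  have m1 : 1 <= m.+1%:R :> R by rewrite ler1n.
  by rewrite -[m.+2%:R]natr1; lra.
have -> : x / m.+1%:R ^+ 2 * eps =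
    (eps * lambda k eps b / m.+1%:R) * (m.+2%:R * ln (2 : R) / m.+1%:R).
  by rewrite /x; field; rewrite lt0r_neq0.
rewrite mulrC ler_pM //; first by rewrite divr_ge0 // mulr_ge0 // ltW.
by rewrite divr_ge0 // mulr_ge0 // ltW.
Qed.

Lemma small_gap_sum_pow2_le (R : realType) (k m0 m : nat) (eps : R) : (0 < k)%N -> 0 < eps ->
  (14 <= m0)%N -> iter k (@expR R) 1 <= 2 ^+ m0 -> (m0 <= m)%N ->
  \sum_(0 <= p < 2 ^ m.+1 | small_gap_prime k eps p) 1 / p%:R <=
  \sum_(0 <= p < 2 ^ m0.+1 | small_gap_prime k eps p) 1 / p%:R +
  2 * gap_const R / eps *
    (iter_ln k (2 ^+ m0) `^ (- eps) - iter_ln k (2 ^+ m) `^ (- eps)).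
Proof.
move=> k0 e0 m14 km; elim: m => [|m IHm] mm; first by have := leq_trans m14 mm.
move: mm; rewrite leq_eqVlt => /orP[/eqP <-|]; first by rewrite subrr mulr0 addr0.
rewrite ltnS => mm; rewrite (@big_cat_nat _ _ _ (2 ^ m.+1)%N) ?leq_exp2l //=.
have km' : iter k (@expR R) 1 <= 2 ^+ m by rewrite (le_trans km) // ler_eXn2l // ltr1n.
apply: le_trans (lerD (IHm mm) (small_gap_block_le k0 e0 (leq_trans m14 mm) km')) _.
by rewrite -addrA -mulrDr lerD2l addrA subrK.
Qed.

Local Open Scope classical_set_scope.

Theorem mainTheorem3 (R : realType) (k : nat) (eps : R)
    (hk : (2 <= k)%N) (heps : 0 < eps) :
  bounded_near (fun x : R => small_gap_sum k eps x) +oo%R.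
Proof.
have k0 : (0 < k)%N by apply: ltnW.
(* From [2 ^+ m0] on, both the sieve estimate and the positivity of the iterated logarithms are
   available. *)
pose m0 := maxn 14 (Num.truncn (iter k (@expR R) 1)).+1.
have m14 : (14 <= m0)%N by rewrite leq_maxl.
have km : iter k (@expR R) 1 <= 2 ^+ m0.
  apply: ltW; apply: lt_le_trans (truncnS_gt _) _.
  by rewrite -natrX ler_nat (leq_trans (leq_maxr 14 _)) // ltnW // ltn_expl.
have t0 p : 0 <= 1 / p%:R :> R by rewrite divr_ge0.
(* The bound is the finite initial sum plus the telescoped total, whose last, negative term is
   dropped. *)
apply/ex_bound; exists (\sum_(0 <= p < 2 ^ m0.+1 | small_gap_prime k eps p) 1 / p%:R +
  2 * gap_const R / eps * iter_ln k (2 ^+ m0) `^ (- eps)).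
near=> x; rewrite /= ger0_norm; last by apply: sumr_ge0.
(* The sum is extended to complete blocks: [Num.truncn x < 2 ^ m.+1], and all terms are
   nonnegative. *)
pose m := maxn m0 (Num.truncn x).
apply: (@le_trans _ _ (\sum_(0 <= p < 2 ^ m.+1 | small_gap_prime k eps p) 1 / p%:R)).
  rewrite /small_gap_sum [leRHS](@big_cat_nat _ _ _ (Num.truncn x).+1) //=.
    by rewrite lerDl sumr_ge0.
  by rewrite (leq_trans (ltn_expl _ (ltnSn 1))) // leq_exp2l // leqW // leq_maxr.
apply: le_trans (small_gap_sum_pow2_le k0 heps m14 km (leq_maxl _ _)) _.
rewrite lerD2l ler_wpM2l ?gerBl ?powR_ge0 // divr_ge0 ?(ltW heps) //.
by rewrite mulr_ge0 // (ltW (gap_const_gt0 R)).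
Unshelve. all: by end_near.
Qed.
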